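(* Consider the composite optimization problem of minimizing $\varphi_0(x)+(\vartheta\circ f)(x)$ over $x\in\mathbb{R}^n$, where $\varphi_0\colon\mathbb{R}^n\to\mathbb{R}$ and $f\colon\mathbb{R}^n\to\mathbb{R}^m$ are twice differentiable at $\bar x$, and where $\vartheta\colon\mathbb{R}^m\to\overline{\mathbb{R}}$ is convex piecewise linear-quadratic with $f(\bar x)\in\operatorname{dom}\vartheta$. Let $(\bar x,\bar\lambda)$ be a solution to the KKT system $$\nabla_xL(x,\lambda)=\nabla\varphi_0(x)+\nabla f(x)^*\lambda=0,\qquad\lambda\in\partial\vartheta\big(f(x)\big).$$ Then the following conditions are equivalent: (i) The set of Lagrange multipliers $\Lambda(\bar x,\bar v):=\{\lambda\in\mathbb{R}^m\mid\nabla f(\bar x)^*\lambda=\bar v,\ \lambda\in\partial\vartheta(f(\bar x))\}$ with $\bar v:=-\nabla\varphi_0(\bar x)$ is a singleton: $\Lambda(\bar x,\bar v)=\{\bar\lambda\}$. (ii) The qualification condition $$\big(D\partial\vartheta\big)\big(f(\bar x),\bar\lambda\big)(0)\cap\ker\nabla f(\bar x)^*=\{0\}$$ holds, with $(D\partial\vartheta)(f(\bar x),\bar\lambda)(0)=K_\vartheta(f(\bar x),\bar\lambda)^*$.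
   Context: $\overline{\mathbb{R}}:=(-\infty,\infty]$, $\operatorname{dom}\vartheta:=\{y\mid\vartheta(y)<\infty\}$. $^*$ denotes the transpose for matrices and the polar cone for cones, $K^*:=\{u\mid\langle u,w\rangle\le0\ \text{for all }w\in K\}$. The Lagrangian is $L(x,\lambda):=\varphi_0(x)+\langle\lambda,f(x)\rangle-\vartheta^*(\lambda)$, with $\vartheta^*$ the Fenchel conjugate. A mapping is twice differentiable at $\bar x$ if it is differentiable in a neighborhood of $\bar x$ and its derivative is differentiable at $\bar x$. $\vartheta$ is piecewise linear-quadratic if $\operatorname{dom}\vartheta=\bigcup_{i=1}^s\Omega_i$ with polyhedral convex sets $\Omega_i$ and $\vartheta(y)=\frac12\langle A_iy,y\rangle+\langle a_i,y\rangle+\alpha_i$ for $y\in\Omega_i$, with symmetric matrices $A_i$, $a_i\in\mathbb{R}^m$, $\alpha_i\in\mathbb{R}$. $\partial\vartheta$ is the subdifferential of convex analysis. Subderivative: $\mathrm{d}\vartheta(\bar y)(\bar w):=\liminf_{t\downarrow 0,\,w\to\bar w}\frac{\vartheta(\bar y+tw)-\vartheta(\bar y)}{t}$. Critical cone: $K_\vartheta(\bar y,\bar u):=\{w\mid\mathrm{d}\vartheta(\bar y)(w)=\langle\bar u,w\rangle\}$ for $(\bar y,\bar u)\in\operatorname{gph}\partial\vartheta$. Tangent cone: $T_\Omega(\bar x):=\{w\mid\exists\,t_k\downarrow0,\ w_k\to w,\ \bar x+t_kw_k\in\Omega\}$. Graphical derivative of a set-valued mapping $S$ at $(\bar x,\bar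 y)\in\operatorname{gph}S$: $DS(\bar x,\bar y)(u):=\{v\mid(u,v)\in T_{\operatorname{gph}S}(\bar x,\bar y)\}$. *)

(* Defs.v *)
From HB Require Import structures.
From mathcomp Require Export all_boot all_order all_algebra.
From mathcomp Require Export all_classical all_reals all_analysis.
From mathcomp Require Import lra.
Export Order.TTheory GRing.Theory Num.Theory.
Export numFieldNormedType.Exports.

Set Implicit Arguments.
Unset Strict Implicit.
Unset Printing Implicit Defensive.

Local Open Scope classical_set_scope.
Local Open Scope ring_scope.

(* R^n is 'rV[R]_n.  Vectors are rows, so in the library's convention a matrix *)
(* acts on the right: 'd f x h = h *m jacobian f x.  The adjoint of the        *)
(* derivative, written nabla f(x)^* for the m x n Jacobian, is therefore       *)
(* lambda |-> lambda *m (jacobian f x)^T.                                      *)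

Definition dotv (R : realType) (n : nat) (u v : 'rV[R]_n) : R :=
  \sum_(i < n) u 0 i * v 0 i.

Section Differentiation.
Variables (R : realType) (n m : nat).

Definition gradient (phi : 'rV[R]_n -> R^o) (x : 'rV[R]_n) : 'rV[R]_n :=
  \row_(i < n) 'd phi x (delta_mx 0 i).

Definition adjoint_derivative (f : 'rV[R]_n -> 'rV[R]_m) (x : 'rV[R]_n)
    (lambda : 'rV[R]_m) : 'rV[R]_n :=
  lambda *m (jacobian f x)^T.

(* For both maps below, being differentiable at xbar is understood in the      *)
(* Frechet sense, with the derivative read as a map into row vectors,          *)
(* respectively into matrices.                                                 *)
Definition twice_differentiable_scalar (phi : 'rV[R]_n -> R^o)
    (xbar : 'rV[R]_n) : Prop :=
  (\forall x \near xbar, differentiable phi x) /\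
  differentiable (gradient phi) xbar.

Definition twice_differentiable (f : 'rV[R]_n -> 'rV[R]_m)
    (xbar : 'rV[R]_n) : Prop :=
  (\forall x \near xbar, differentiable f x) /\
  differentiable (jacobian f) xbar.

End Differentiation.

Section ConvexAnalysis.
Variables (R : realType) (m : nat).
Implicit Types (theta : 'rV[R]_m -> \bar R) (K : set 'rV[R]_m).

Definition never_ninfty theta : Prop := forall y, theta y != -oo%E.

Definition edom theta : set 'rV[R]_m := [set y | (theta y < +oo)%E].

Definition convex_efun theta : Prop :=
  forall (y z : 'rV[R]_m) (t : R), 0 < t < 1 ->
    (theta (t *: y + (1 - t) *: z)%R
       <= t%:E * theta y + (1 - t)%:E * theta z)%E.

Definition polyhedral_convex (Omega : set 'rV[R]_m) : Prop :=
  exists (p : nat) (b : 'I_p -> 'rV[R]_m) (c : 'I_p -> R),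
    Omega = [set y | forall j, dotv (b j) y <= c j].

Definition piecewise_linear_quadratic theta : Prop :=
  exists (s : nat) (Omega : 'I_s -> set 'rV[R]_m) (A : 'I_s -> 'M[R]_m)
         (a : 'I_s -> 'rV[R]_m) (alpha : 'I_s -> R),
    [/\ forall i, polyhedral_convex (Omega i),
        forall i, (A i)^T = A i,
        edom theta = \bigcup_(i in [set: 'I_s]) Omega i &
        forall i y, Omega i y ->
          theta y = (2^-1 * dotv (y *m A i) y + dotv (a i) y + alpha i)%:E].

(* The subdifferential is empty outside the domain. *)
Definition subdifferential theta (y : 'rV[R]_m) : set 'rV[R]_m :=
  [set u | edom theta y /\
    forall z, (theta y + (dotv u (z - y)%R)%:E <= theta z)%E].

Definition conjugate theta (u : 'rV[R]_m) : \bar R :=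
  ereal_sup (range (fun y => ((dotv u y)%:E - theta y)%E)).

Definition subderivative theta (ybar wbar : 'rV[R]_m) : \bar R :=
  limf_einf
    (fun tw : R * 'rV[R]_m =>
       ((theta (ybar + tw.1 *: tw.2)%R - theta ybar) * (tw.1^-1)%:E)%E)
    (filter_prod 0^'+ (nbhs wbar)).

Definition critical_cone theta (ybar ubar : 'rV[R]_m) : set 'rV[R]_m :=
  [set w | subderivative theta ybar w = (dotv ubar w)%:E].

Definition polar_cone K : set 'rV[R]_m :=
  [set u | forall w, K w -> dotv u w <= 0].

End ConvexAnalysis.

Section VariationalGeometry.
Variable R : realType.

Definition tangent_cone (V : normedModType R) (Omega : set V) (xbar : V) :
    set V :=
  [set w | exists (t : nat -> R) (wk : nat -> V),
    [/\ forall k, 0 < t k, t @ \oo --> (0 : R), wk @ \oo --> w &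
        forall k, Omega (xbar + t k *: wk k)]].

Definition gph (U V : normedModType R) (S : U -> set V) : set (U * V)%type :=
  [set p | S p.1 p.2].

Definition graphical_derivative (U V : normedModType R) (S : U -> set V)
    (xbar : U) (ybar : V) (u : U) : set V :=
  [set v | tangent_cone (gph S) (xbar, ybar) (u, v)].

End VariationalGeometry.

Section CompositeProblem.
Variables (R : realType) (n m : nat).
Variables (phi0 : 'rV[R]_n -> R^o) (f : 'rV[R]_n -> 'rV[R]_m).
Variable theta : 'rV[R]_m -> \bar R.

Definition lagrangian (x : 'rV[R]_n) (lambda : 'rV[R]_m) : \bar R :=
  ((phi0 x + dotv lambda (f x))%:E - conjugate theta lambda)%E.

(* The stationarity condition is nabla_x L(x, lambda) = 0 written out; see     *)
(* gradient_lagrangian below.                                                  *)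
Definition kkt (x : 'rV[R]_n) (lambda : 'rV[R]_m) : Prop :=
  gradient phi0 x + adjoint_derivative f x lambda = 0 /\
  subdifferential theta (f x) lambda.

Definition multipliers (x v : 'rV[R]_n) : set 'rV[R]_m :=
  [set lambda | adjoint_derivative f x lambda = v /\
                subdifferential theta (f x) lambda].

Lemma conjugate_fin_num (y lambda : 'rV[R]_m) :
  never_ninfty theta -> subdifferential theta y lambda ->
  conjugate theta lambda \is a fin_num.
Proof.
move=> thetaN [ydom sub].
have yfin : theta y \is a fin_num by rewrite fin_numE thetaN lt_eqF.
have -> : conjugate theta lambda = ((dotv lambda y)%:E - theta y)%E.
  apply/eqP; rewrite eq_le; apply/andP; split; last first.
    by apply: ereal_sup_ubound; exists y.
  apply: ge_ereal_sup => _ [z _ <-].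
  have := sub z; rewrite -(fineK yfin).
  have -> : dotv lambda (z - y) = dotv lambda z - dotv lambda y.
    by rewrite /dotv -sumrB; apply: eq_bigr => i _; rewrite !mxE mulrBr.
  case: (theta z) (thetaN z) => [r| |] //= _; last by rewrite leNye.
  by rewrite -!EFinD !lee_fin => h; lra.
by rewrite fin_numB yfin.
Qed.

Lemma gradient_lagrangian (x : 'rV[R]_n) (lambda : 'rV[R]_m) :
  differentiable phi0 x -> differentiable f x ->
  conjugate theta lambda \is a fin_num ->
  gradient (fun z => fine (lagrangian z lambda)) x =
    gradient phi0 x + adjoint_derivative f x lambda.
Proof.
move=> dphi df cfin.
pose c := fine (conjugate theta lambda).
have dot_lin : linear (dotv lambda : 'rV[R]_m -> R^o).
  move=> a u v; rewrite /dotv scaler_sumr -big_split /=.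
  by apply: eq_bigr => i _; rewrite !mxE mulrDr /GRing.scale /= mulrCA.
pose g : {linear 'rV[R]_m -> R^o} :=
  HB.pack (dotv lambda : 'rV[R]_m -> R^o)
    (GRing.isLinear.Build R 'rV[R]_m R^o _ (dotv lambda) dot_lin).
have g_cont : continuous g.
  move=> y; apply: differentiable_continuous.
  have -> : (g : 'rV[R]_m -> R^o) =
      \sum_(i < m) (fun u : 'rV[R]_m => lambda 0 i *: (u 0 i : R^o)).
    by apply/funext => u; rewrite fct_sumE.
  apply: differentiable_sum => i.
  exact/differentiableZ/differentiable_coord.
have dg y : differentiable g y by exact: linear_differentiable.
have -> : (fun z => fine (lagrangian z lambda)) =
    (phi0 + (g \o f) - cst c : 'rV[R]_n -> R^o).
  by apply/funext => z; rewrite /lagrangian -(fineK cfin).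
have dgf : differentiable (g \o f) x by exact: differentiable_comp.
have dsum : differentiable (phi0 + (g \o f)) x by exact: differentiableD.
apply/rowP => i; rewrite !mxE diffB // diffD // (diff_comp df (dg _)).
rewrite diff_cst /= subr0 (diff_lin _ g_cont) /=; congr (_ + _).
by apply: eq_bigr => j _; rewrite !mxE.
Qed.

End CompositeProblem.

(* Main.v *)
From mathcomp Require Import ring lra.
Require Import Defs.

Set Implicit Arguments.
Unset Strict Implicit.
Unset Printing Implicit Defensive.

Local Open Scope classical_set_scope.
Local Open Scope ring_scope.

(** Write [y = f xbar], [u = lambdabar], [K] for the critical cone of [theta] at
    [(y, u)] and [S] for the convex set of subgradients of [theta] at [y].  The
    whole theorem rests on one fact: the graphical derivative at [0], the polar
    cone [K^*] and the cone of directions [v] with [u + t v] in [S] for some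
    [t > 0] are the same set.  Granting it, a nonzero [v] in [K^*] killed by the
    adjoint of the derivative of [f] gives a second multiplier [u + t v], and
    conversely a second multiplier [lam] gives such a direction [lam - u].  Only
    linearity of the adjoint enters here; all the analysis concerns [theta].
    The three sets are shown equal by inclusions in a circle, resting on a local
    description of [theta] and [K].

    The pieces [Omega i] are polyhedral, so whether [y + t w] stays in [Omega i]
    for small [t > 0] is decided by finitely many linear inequalities on [w]
    (polyhedral_feasible_cone).  Along such a direction [theta] is an explicit
    quadratic in [t], with slope [<u, w> + <c i, w>] where [c i] is the gradient
    of the [i]-th quadratic at [y] minus [u] (slope_gap); as [u] is a subgradient,
    [<c i, w> >= 0].  Directions with [<c i, w> = 0] for some such [i] make up
    exactly [K] (critical_coneP).

    From [K^*] to [S] (polar_multiplier): on the polyhedral cone attached to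
    piece [i], the inequality [<v, w> <= 0] holds wherever [<c i, w> <= 0].
    Farkas' lemma turns this into [<v, w> <= sigma <c i, w>] on the whole cone,
    so [t <v, w> <= <c i, w>] for small [t].  There are finitely many pieces, so
    one [t] serves them all, and by convexity these first order inequalities at
    [y] yield the global subgradient inequality for [u + t v].

    From [S] to the graphical derivative (multiplier_graphical_derivative):
    [S] is convex, so the base point may be kept at [y] while the subgradient
    moves along the segment from [u] to [u + t v].

    From the graphical derivative to [K^*] (graphical_derivative_polar): let
    [u + t_k v_k] be a subgradient at [y + t_k w_k] with [w_k -> 0] and
    [v_k -> v], and let [w] be in [K].  Testing that subgradient inequality at
    [y + r t_k w], where [theta] is quadratic with slope [<u, w>], makes all
    first order terms cancel; dividing by [t_k ^ 2] and passing to the limit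
    gives [<v, w> <= r q / 2] with [q] the value at [w] of the quadratic form of
    the piece.  Now let [r] tend to [0]. *)

(** * Inner products *)

Section DotProduct.
Variables (R : realType) (m : nat).
Implicit Types (u v w : 'rV[R]_m) (t : R).

Lemma dotv_mx u v : dotv u v = (u *m v^T) 0 0.
Proof. by rewrite !mxE; apply: eq_bigr => i _; rewrite mxE. Qed.

Lemma dotvC u v : dotv u v = dotv v u.
Proof. by apply: eq_bigr => i _; rewrite mulrC. Qed.

Lemma dotvDl u v w : dotv (u + v) w = dotv u w + dotv v w.
Proof. by rewrite !dotv_mx mulmxDl mxE. Qed.

Lemma dotvZl t u w : dotv (t *: u) w = t * dotv u w.
Proof. by rewrite !dotv_mx -scalemxAl mxE. Qed.

Lemma dotvDr u v w : dotv w (u + v) = dotv w u + dotv w v.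
Proof. by rewrite dotvC dotvDl !(dotvC w). Qed.

Lemma dotvZr t u w : dotv w (t *: u) = t * dotv w u.
Proof. by rewrite dotvC dotvZl dotvC. Qed.

Lemma dotvBl u v w : dotv (u - v) w = dotv u w - dotv v w.
Proof. by rewrite -scaleN1r dotvDl dotvZl mulN1r. Qed.

Lemma dotvBr u v w : dotv w (u - v) = dotv w u - dotv w v.
Proof. by rewrite dotvC dotvBl !(dotvC w). Qed.

Lemma dotv0l w : dotv 0 w = 0.
Proof. by rewrite -(scale0r w) dotvZl mul0r. Qed.

(** The rules for differences come first: the rule for sums also matches
    [u - v] and would leave [dotv (- v) w] behind. *)
Definition dotvE := (dotvBl, dotvBr, dotvDl, dotvDr, dotvZl, dotvZr).

Lemma dotv_suml (I : finType) (b : I -> 'rV[R]_m) w :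
  dotv (\sum_i b i) w = \sum_i dotv (b i) w.
Proof.
apply: (big_ind2 (fun x y => dotv x w = y)); rewrite ?dotv0l//.
by move=> x1 x2 y1 y2 <- <-; rewrite dotvDl.
Qed.

Lemma dotv_mulmx_sym (A : 'M[R]_m) u v :
  A^T = A -> dotv (u *m A) v = dotv (v *m A) u.
Proof.
by move=> Asym; rewrite [RHS]dotvC !dotv_mx trmx_mul Asym mulmxA.
Qed.

Lemma cvg_sumr (T : Type) (F : set_system T) (FF : Filter F) (I : finType)
    (h : I -> T -> R) (l : I -> R) :
  (forall i, h i @ F --> l i) ->
  (fun k => \sum_i h i k) @ F --> \sum_i l i.
Proof.
move=> hl; have := @cvg_big R I +%R 0 xpredT add_continuous T F (index_enum I).
by move=> /(_ h l FF); apply=> i _; exact: hl.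
Qed.

Lemma cvg_coord (T : Type) (F : set_system T) (FF : Filter F)
    (u : T -> 'rV[R]_m) (u0 : 'rV[R]_m) i :
  u @ F --> u0 -> (fun k => u k 0 i) @ F --> u0 0 i.
Proof.
by move=> uu0; exact: (cvg_comp _ _ uu0 (@coord_continuous _ _ _ _ _ _)).
Qed.

Lemma cvg_dotv (T : Type) (F : set_system T) (FF : Filter F)
    (u v : T -> 'rV[R]_m) (u0 v0 : 'rV[R]_m) :
  u @ F --> u0 -> v @ F --> v0 ->
  (fun k => dotv (u k) (v k)) @ F --> dotv u0 v0.
Proof.
by move=> uu0 vv0; apply: cvg_sumr => i; apply: cvgM; exact: cvg_coord.
Qed.

Lemma cvg_quadratic_form (T : Type) (F : set_system T) (FF : Filter F)
    (A : 'M[R]_m) (u : T -> 'rV[R]_m) (u0 : 'rV[R]_m) :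
  u @ F --> u0 ->
  (fun k => dotv (u k *m A) (u k)) @ F --> dotv (u0 *m A) u0.
Proof.
have formE w : dotv (w *m A) w = \sum_i w 0 i * dotv (row i A) w.
  by rewrite mulmx_sum_row dotv_suml; apply: eq_bigr => i _; rewrite dotvZl.
move=> uu0; rewrite formE; under eq_fun do rewrite formE.
apply: cvg_sumr => i; apply: cvgM; first exact: cvg_coord.
by apply: cvg_dotv => //; exact: cvg_cst.
Qed.

(** Induction on the number of functionals.  If dropping the first one
    invalidates the implication, some [w0] has [dotv v w0 > 0] while all the
    other [b j] are nonpositive at [w0], which forces [dotv (b ord0) w0 > 0].
    Composing every functional with the projection along [w0] onto the kernel of
    [b ord0] removes [b ord0] from the family, so the induction hypothesis
    applies; undoing the projection only changes the coefficient of [b ord0],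
    whose sign is controlled by the choice of [w0]. *)
Lemma farkas (p : nat) (b : 'I_p -> 'rV[R]_m) v :
  (forall w, (forall j, dotv (b j) w <= 0) -> dotv v w <= 0) ->
  exists2 mu : 'I_p -> R, (forall j, 0 <= mu j) & v = \sum_j mu j *: b j.
Proof.
elim: p b v => [|p IH] b v vle0.
  exists (fun=> 0) => //; rewrite big_ord0.
  have vv : dotv v v <= 0 by apply: vle0 => -[].
  have /eqP : dotv v v = 0.
    by apply/eqP; rewrite eq_le vv sumr_ge0// => i _; rewrite -expr2 sqr_ge0.
  rewrite psumr_eq0 => [|i _]; last by rewrite -expr2 sqr_ge0.
  move=> /allP v0; apply/rowP => i; rewrite mxE.
  by have /(_ (mem_index_enum i)) := v0 i; rewrite /= mulf_eq0 orbb => /eqP.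
pose b' j := b (lift ord0 j).
have [vle0'|] := pselect
  (forall w, (forall j, dotv (b' j) w <= 0) -> dotv v w <= 0).
  have [mu mu0 ->] := IH b' v vle0'.
  exists (fun j => oapp mu 0 (unlift ord0 j)) => [j|].
    by case: (unlift ord0 j) => [i|] /=.
  rewrite big_ord_recl unlift_none scale0r add0r.
  by apply: eq_bigr => j _; rewrite liftK.
move=> /existsNP[w0 /not_implyP[w0le /negP]]; rewrite -ltNge => vw0.
have bw0 : 0 < dotv (b ord0) w0.
  rewrite ltNge; apply/negP => bw0.
  suff : dotv v w0 <= 0 by rewrite leNgt vw0.
  by apply: vle0 => j; case: (unliftP ord0 j) => [i|] -> //; exact: w0le.
(* [proj] is the transpose of the projection [projt] along [w0]. *)
pose proj (x : 'rV[R]_m) := x - (dotv x w0 / dotv (b ord0) w0) *: b ord0.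
pose projt (w : 'rV[R]_m) := w - (dotv (b ord0) w / dotv (b ord0) w0) *: w0.
have projE x w : dotv (proj x) w = dotv x (projt w).
  by rewrite !dotvE; ring.
have [w hw|mu mu0 vE] := IH (proj \o b') (proj v).
  rewrite projE; apply: vle0 => j; case: (unliftP ord0 j) => [i|] -> /=.
    by rewrite -projE; exact: hw.
  by rewrite !dotvE divfK ?gt_eqF// subrr.
pose c := (dotv v w0 - \sum_j mu j * dotv (b' j) w0) / dotv (b ord0) w0.
have c0 : 0 <= c.
  rewrite divr_ge0 ?(ltW bw0)// subr_ge0 (le_trans _ (ltW vw0))//.
  by apply: sumr_le0 => j _; rewrite mulr_ge0_le0.
exists (fun j => oapp mu c (unlift ord0 j)) => [j|].
  by case: (unlift ord0 j) => [i|] /=.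
rewrite big_ord_recl unlift_none /=.
under eq_bigr do rewrite liftK /=.
have -> : v = proj v + (dotv v w0 / dotv (b ord0) w0) *: b ord0 by rewrite subrK.
have -> : proj v = \sum_j mu j *: b' j
    - ((\sum_j mu j * dotv (b' j) w0) / dotv (b ord0) w0) *: b ord0.
  rewrite vE mulr_suml scaler_suml -sumrB; apply: eq_bigr => j _.
  by rewrite scalerBr scalerA mulrA.
by rewrite -addrA [in RHS]addrC; congr (_ + _); rewrite /c mulrBl scalerBl addrC.
Qed.

End DotProduct.

(** * Feasible directions of polyhedral sets *)

Section Polyhedral.
Variables (R : realType) (m : nat).
Implicit Types (Omega : set 'rV[R]_m) (v w y : 'rV[R]_m).

(** A Lagrange multiplier for one distinguished constraint [c]: in the
    Farkas representation of [v] the terms coming from the [b j] are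
    nonpositive on the cone and can be dropped. *)
Lemma farkas_multiplier (p : nat) (b : 'I_p -> 'rV[R]_m) (c v : 'rV[R]_m) :
  (forall w, (forall j, dotv (b j) w <= 0) -> dotv c w <= 0 -> dotv v w <= 0) ->
  exists2 sigma : R, 0 <= sigma &
    forall w, (forall j, dotv (b j) w <= 0) -> dotv v w <= sigma * dotv c w.
Proof.
move=> vle0; pose bc (j : 'I_p.+1) := oapp b c (unlift ord0 j).
have [w bcw|mu mu0 vE] := @farkas _ _ _ bc v.
  apply: vle0 => [j|].
    by have := bcw (lift ord0 j); rewrite /bc liftK.
  by have := bcw ord0; rewrite /bc unlift_none.
exists (mu ord0) => // w bw.
rewrite vE big_ord_recl /bc unlift_none /= dotvDl dotvZl dotv_suml gerDl.
by apply: sumr_le0 => j _; rewrite liftK /= dotvZl mulr_ge0_le0.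
Qed.

Definition feasible_direction Omega y w : Prop :=
  \forall s \near (0 : R)^'+, Omega (y + s *: w).

Lemma cvg_ray y w :
  (fun tw : R * 'rV[R]_m => y + tw.1 *: tw.2)
    @ filter_prod 0^'+ (nbhs w) --> y.
Proof.
have y0 : y + 0 *: w = y by rewrite scale0r addr0.
rewrite -[X in _ --> X]y0.
apply: cvgD; first exact: cvg_cst.
apply: cvgZ; last exact: cvg_snd.
apply: cvg_trans; first exact: cvg_fst.
exact: cvg_within.
Qed.

Lemma cvg_ray_fixed y w : (fun t : R => y + t *: w) @ (0 : R)^'+ --> y.
Proof.
have y0 : y + 0 *: w = y by rewrite scale0r addr0.
rewrite -[X in _ --> X]y0.
apply: cvgD; first exact: cvg_cst.
apply: cvgZ; last exact: cvg_cst.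
exact: cvg_within.
Qed.

(** The normals are those of the constraints active at [y]; inactive ones
    are replaced by [0], so that the index set stays the same.  Leaving the two
    implications separate keeps the stronger half of each: a single step [t > 0]
    inside [Omega] forces the inequalities, and these allow all small steps. *)
Lemma polyhedral_feasible_cone Omega y :
  polyhedral_convex Omega -> Omega y ->
  exists (p : nat) (b : 'I_p -> 'rV[R]_m),
    (forall w t, 0 < t -> Omega (y + t *: w) -> forall j, dotv (b j) w <= 0) /\
    (forall w, (forall j, dotv (b j) w <= 0) -> feasible_direction Omega y w).
Proof.
move=> [p [b [c ->]]] /= yb.
exists p, (fun j => if dotv (b j) y == c j then b j else 0); split.
  move=> w t t0 yt j; case: eqP => [bc|_]; last by rewrite dotv0l.
  by have := yt j; rewrite !dotvE bc gerDl pmulr_rle0.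
move=> w bw; apply: filter_forall => j /=.
have := bw j; case: eqP => [bc bwj|/eqP bc _].
  apply: filterS (nbhs_right_gt 0) => t t0.
  by rewrite !dotvE bc gerDl pmulr_rle0.
have bcvg : (fun t : R => dotv (b j) (y + t *: w)) @ (0 : R)^'+
    --> dotv (b j) y.
  by apply: cvg_dotv; [exact: cvg_cst|exact: cvg_ray_fixed].
by apply: (cvgr_le _ bcvg); rewrite lt_neqAle bc yb.
Qed.

(** Perturbing the direction along with the step is what the lower limit
    defining the subderivative requires; a constant direction is a special case. *)
Lemma not_feasible_near Omega y w :
  polyhedral_convex Omega -> ~ (Omega y /\ feasible_direction Omega y w) ->
  \forall tw \near filter_prod (0 : R)^'+ (nbhs w), ~ Omega (y + tw.1 *: tw.2).
Proof.
move=> polyO notf; have [Oy|nOy] := pselect (Omega y).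
  have [p [b [bO Ob]]] := polyhedral_feasible_cone polyO Oy.
  have /existsNP[j /negP] : ~ forall j, dotv (b j) w <= 0.
    by move=> bw; apply: notf; split => //; exact: Ob.
  rewrite -ltNge => bjw.
  have tw0 : \forall tw \near filter_prod (0 : R)^'+ (nbhs w), 0 < tw.1.
    by apply: (@cvg_fst _ _ _ (nbhs w) _ [set t : R | 0 < t]); exact: nbhs_right_gt.
  have btw : \forall tw \near filter_prod (0 : R)^'+ (nbhs w),
      0 < dotv (b j) tw.2.
    have bcvg : dotv (b j) tw.2 @[tw --> filter_prod (0 : R)^'+ (nbhs w)]
        --> dotv (b j) w by apply: cvg_dotv; [exact: cvg_cst|exact: cvg_snd].
    exact: (cvgr_gt _ bcvg).
  apply: filterS2 tw0 btw => tw t0 bt Ot.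
  by have := bO _ _ t0 Ot j; rewrite leNgt bt.
have [p [b [c OE]]] := polyO.
have /existsNP[j /negP] : ~ forall j, dotv (b j) y <= c j by rewrite OE in nOy.
rewrite -ltNge => bjy.
have : \forall tw \near filter_prod (0 : R)^'+ (nbhs w),
    c j < dotv (b j) (y + tw.1 *: tw.2).
  have bcvg : dotv (b j) (y + tw.1 *: tw.2)
      @[tw --> filter_prod (0 : R)^'+ (nbhs w)] --> dotv (b j) y.
    by apply: cvg_dotv; [exact: cvg_cst|exact: cvg_ray].
  exact: (cvgr_gt _ bcvg).
by apply: filterS => tw; rewrite OE ltNge => /negP nb /= /(_ j).
Qed.

End Polyhedral.

(** * Bounds on lower limits *)

Section LowerLimit.
Variables (R : realType) (T : choiceType) (X : filteredType T).
Implicit Types (g : X -> \bar R) (F : set_system X).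

Lemma limf_einf_ge g F (c : \bar R) :
  (\forall x \near F, (c <= g x)%E) -> (c <= limf_einf g F)%E.
Proof.
move=> Fc; rewrite limf_einfE; apply: le_ereal_sup_tmp.
exists (ereal_inf (g @` [set x | (c <= g x)%E])).
  by exists [set x | (c <= g x)%E].
by apply/ereal_infP => _ [x /= cg <-].
Qed.

Lemma limf_einf_le g F (c : \bar R) :
  (forall V, F V -> exists2 x, V x & (g x <= c)%E) -> (limf_einf g F <= c)%E.
Proof.
move=> Vc; rewrite limf_einfE; apply: ge_ereal_sup => _ [V FV <-].
by have [x Vx gx] := Vc V FV; apply: ge_ereal_inf; exists (g x) => //; exists x.
Qed.

End LowerLimit.

(** * Piecewise linear-quadratic functions *)

Section PiecewiseQuadratic.
Variables (R : realType) (m : nat).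

Definition quadratic (A : 'M[R]_m) (a : 'rV[R]_m) (alpha : R) (y : 'rV[R]_m) :=
  2^-1 * dotv (y *m A) y + dotv a y + alpha.

Lemma quadratic_line (A : 'M[R]_m) a alpha (y w : 'rV[R]_m) t : A^T = A ->
  quadratic A a alpha (y + t *: w) = quadratic A a alpha y +
    t * (dotv (y *m A + a) w + t / 2 * dotv (w *m A) w).
Proof.
move=> Asym; rewrite /quadratic mulmxDl -scalemxAl !dotvE.
rewrite (dotv_mulmx_sym w y Asym); lra.
Qed.

Lemma affine_ge0_near0 (a b : R) :
  (\forall t \near 0^'+, 0 <= a + t * b) -> 0 <= a.
Proof.
move=> abt; apply: (ler_cvg_to (cvg_cst 0) _ abt).
rewrite -[X in _ --> X]addr0 -[X in _ --> _ + X](mul0r b).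
by apply: cvgD; [exact: cvg_cst|apply: cvgM; [exact: cvg_within|exact: cvg_cst]].
Qed.

Variables (theta : 'rV[R]_m -> \bar R) (s : nat) (Omega : 'I_s -> set 'rV[R]_m).
Variables (A : 'I_s -> 'M[R]_m) (a : 'I_s -> 'rV[R]_m) (alpha : 'I_s -> R).
Hypothesis theta_proper : never_ninfty theta.
Hypothesis theta_convex : convex_efun theta.
Hypothesis Omega_polyhedral : forall i, polyhedral_convex (Omega i).
Hypothesis A_sym : forall i, (A i)^T = A i.
Hypothesis dom_theta : edom theta = \bigcup_(i in [set: 'I_s]) Omega i.
Hypothesis theta_piece : forall i y, Omega i y ->
  theta y = (quadratic (A i) (a i) (alpha i) y)%:E.
Variables (y u : 'rV[R]_m).
Hypothesis sub_u : subdifferential theta y u.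

(** Pieces that contain [y] and along which one can leave [y] in direction
    [w]: only these matter for the first order behaviour of [theta] at [y]. *)
Definition active_direction i w := Omega i y /\ feasible_direction (Omega i) y w.

(** The excess over [u] of the gradient at [y] of the [i]-th quadratic; it
    is meaningful only when [Omega i] contains [y]. *)
Definition slope_gap i := y *m A i + a i - u.

Lemma thetaE_fine z : edom theta z -> theta z = (fine (theta z))%:E.
Proof. by move=> zdom; rewrite fineK// fin_numE theta_proper lt_eqF. Qed.

Lemma theta_pinfty z : ~ edom theta z -> theta z = +oo%E.
Proof. by move=> ndom; apply/eqP; rewrite eq_le leey leNgt; apply/negP. Qed.

Lemma subgradient_ray v t w : subdifferential theta y v ->
  ((fine (theta y) + t * dotv v w)%:E <= theta (y + t *: w)%R)%E.
Proof.
move=> [ydom /(_ (y + t *: w))].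
have -> : y + t *: w - y = t *: w by rewrite addrC addKr.
by rewrite dotvZr {1}(thetaE_fine ydom).
Qed.

Lemma piece_ray i w t : Omega i y -> Omega i (y + t *: w) ->
  theta (y + t *: w) = (fine (theta y) +
    t * (dotv u w + dotv (slope_gap i) w + t / 2 * dotv (w *m A i) w))%:E.
Proof.
move=> Oy Oyt; rewrite (theta_piece Oyt) (theta_piece Oy) /= quadratic_line//.
by congr (_ + _ * (_ + _))%:E; rewrite /slope_gap !dotvE; ring.
Qed.

Lemma slope_gap_ge0 i w : active_direction i w -> 0 <= dotv (slope_gap i) w.
Proof.
move=> [Oy feas]; apply: (@affine_ge0_near0 _ (2^-1 * dotv (w *m A i) w)).
apply: filterS2 (nbhs_right_gt 0) feas => t t0 Oyt.
have := subgradient_ray t w sub_u.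
rewrite (piece_ray Oy Oyt) lee_fin lerD2l ler_pM2l//; lra.
Qed.

Let quotient (tw : R * 'rV[R]_m) :=
  ((theta (y + tw.1 *: tw.2)%R - theta y) * (tw.1^-1)%:E)%E.
Local Notation ray_filter w := (filter_prod (0 : R)^'+ (nbhs (w : 'rV[R]_m))).

Lemma quotient_fin t w r : 0 < t ->
  theta (y + t *: w) = (fine (theta y) + t * r)%:E ->
  quotient (t, w) = r%:E.
Proof.
move=> t0 E; rewrite /quotient /= E (thetaE_fine sub_u.1) -EFinB -EFinM /=.
by congr EFin; rewrite [_ + t * r]addrC addrK mulrC mulKf ?gt_eqF.
Qed.

Lemma quotient_pinfty t w : 0 < t -> ~ edom theta (y + t *: w) ->
  quotient (t, w) = +oo%E.
Proof.
move=> t0 ndom; rewrite /quotient /= (thetaE_fine sub_u.1).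
by rewrite (theta_pinfty ndom) addye// gt0_mulye// lte_fin invr_gt0.
Qed.

(** Every subgradient bounds the difference quotients from below, which is
    why the subderivative dominates the support function of the subdifferential. *)
Lemma quotient_ge v t w : subdifferential theta y v -> 0 < t ->
  ((dotv v w)%:E <= quotient (t, w))%E.
Proof.
move=> sub_v t0.
have [ytdom|/(quotient_pinfty t0) ->] := pselect (edom theta (y + t *: w)).
  have := subgradient_ray t w sub_v; rewrite (thetaE_fine ytdom) lee_fin => le.
  rewrite (@quotient_fin _ _ ((fine (theta (y + t *: w)) - fine (theta y)) / t))//.
    by rewrite lee_fin ler_pdivlMr// mulrC lerBrDl.
  by rewrite (thetaE_fine ytdom) mulrC divfK ?gt_eqF// subrKC.
by rewrite leey.
Qed.

Lemma near_ray_gt0 w : \forall tw \near ray_filter w, 0 < tw.1.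
Proof.
by apply: (@cvg_fst _ _ _ (nbhs w) _ [set t : R | 0 < t]); exact: nbhs_right_gt.
Qed.

Lemma subderivative_ge v w : subdifferential theta y v ->
  ((dotv v w)%:E <= subderivative theta y w)%E.
Proof.
move=> sub_v; apply/lee_subgt0Pr => e e0; rewrite -EFinB.
apply: limf_einf_ge.
have vcvg : dotv v tw.2 @[tw --> ray_filter w] --> dotv v w.
  by apply: cvg_dotv; [exact: cvg_cst|exact: cvg_snd].
have ve : dotv v w - e < dotv v w by rewrite ltrBlDr ltrDl.
apply: filterS2 (near_ray_gt0 w) (cvgr_gt _ vcvg _ ve) => -[t x] /= t0 vx.
by apply: le_trans (quotient_ge x sub_v t0); rewrite lee_fin ltW.
Qed.

(** Along an active direction with zero gap the quotients for the constant
    direction [w] tend to [dotv u w], which is also a lower bound for the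
    subderivative.  Conversely, if every active piece has a positive gap, then
    near [w] and for small steps each piece is either avoided or keeps the
    quotient above [dotv u w + e] for a common [e > 0]. *)
Lemma critical_coneP w : critical_cone theta y u w <->
  exists2 i, active_direction i w & dotv (slope_gap i) w = 0.
Proof.
split=> [Kw|[i [Oy feas] gap0]]; last first.
  apply/eqP; rewrite eq_le subderivative_ge// andbT.
  apply/lee_addgt0Pr => e e0; rewrite -EFinD.
  apply: limf_einf_le => V [[P Q] [/= P0 Qw] PQV].
  have qe : \forall t \near (0 : R)^'+, t / 2 * dotv (w *m A i) w < e.
    have qcvg : t / 2 * dotv (w *m A i) w @[t --> (0 : R)^'+] -->
        0 / 2 * dotv (w *m A i) w.
      apply: cvgM; last exact: cvg_cst.
      by apply: cvgM; [exact: cvg_within|exact: cvg_cst].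
    by apply: (cvgr_lt _ qcvg); rewrite !mul0r.
  have [t [[t0 Pt] [Ot te]]] := filter_ex
    (filterI (filterI (nbhs_right_gt 0) P0) (filterI feas qe)).
  exists (t, w); first by apply: PQV; split => //=; exact: nbhs_singleton.
  rewrite [leLHS](quotient_fin t0 (piece_ray Oy Ot)) gap0 addr0 lee_fin lerD2l.
  exact: ltW.
apply: contrapT => noi.
pose above e tw := ((dotv u w + e)%:E <= quotient tw)%E.
have piece_above i : \forall e \near (0 : R)^'+, \forall tw \near ray_filter w,
    Omega i (y + tw.1 *: tw.2) -> above e tw.
  have [acti|nacti] := pselect (active_direction i w); last first.
    near=> e; apply: filterS (not_feasible_near (Omega_polyhedral i) nacti).
    by move=> tw nO /nO.
  have gap_gt0 : 0 < dotv (slope_gap i) w.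
    rewrite lt_neqAle slope_gap_ge0// andbT eq_sym; apply/eqP => gap0.
    by apply: noi; exists i.
  apply: filterS (nbhs_right_lt gap_gt0) => e e_lt.
  pose h (tw : R * 'rV[R]_m) := dotv u tw.2 + dotv (slope_gap i) tw.2
    + tw.1 / 2 * dotv (tw.2 *m A i) tw.2.
  have hcvg : h @ ray_filter w --> dotv u w + dotv (slope_gap i) w
      + 0 / 2 * dotv (w *m A i) w.
    have wcvg : tw.2 @[tw --> ray_filter w] --> w by exact: cvg_snd.
    apply: cvgD.
      by apply: cvgD; apply: cvg_dotv => //; exact: cvg_cst.
    apply: cvgM; last exact: cvg_quadratic_form.
    apply: cvgM; last exact: cvg_cst.
    by apply: cvg_trans; [exact: cvg_fst|exact: cvg_within].
  have h_gt : \forall tw \near ray_filter w, dotv u w + e < h tw.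
    by apply: (cvgr_gt _ hcvg); rewrite !mul0r addr0 ltrD2l.
  apply: filterS2 (near_ray_gt0 w) h_gt => -[t x] /= t0 hx Ox.
  rewrite /above (quotient_fin t0 (piece_ray acti.1 Ox)) lee_fin; exact: ltW.
have [e [e0 e_above]] := filter_ex
  (filterI (nbhs_right_gt 0) (filter_forall _ piece_above)).
have : ((dotv u w + e)%:E <= subderivative theta y w)%E.
  apply: limf_einf_ge.
  apply: filterS2 (near_ray_gt0 w) (filter_forall _ e_above) => -[t x] /= t0 ab.
  have [|/(quotient_pinfty t0)] := pselect (edom theta (y + t *: x)).
    by rewrite dom_theta => -[i _ /ab].
  by rewrite /quotient /= => ->; rewrite leey.
by rewrite Kw lee_fin gerDl leNgt e0.
Unshelve. all: by end_near. Qed.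

(** On [K] the subderivative equals [dotv u w], and it is at least
    [dotv lam w]. *)
Lemma multiplier_polar lam : subdifferential theta y lam ->
  polar_cone (critical_cone theta y u) (lam - u).
Proof.
move=> sub_lam w Kw; rewrite dotvBl subr_le0.
by have := subderivative_ge w sub_lam; rewrite Kw lee_fin.
Qed.

Lemma convex_ray z t : edom theta z -> 0 < t < 1 ->
  (theta (y + t *: (z - y))%R <=
     (fine (theta y) + t * (fine (theta z) - fine (theta y)))%:E)%E.
Proof.
move=> zdom t01; have := theta_convex z y t01.
have -> : t *: z + (1 - t) *: y = y + t *: (z - y).
  by rewrite scalerBl scale1r scalerBr addrCA addrA.
rewrite {1}(thetaE_fine zdom) {1}(thetaE_fine sub_u.1) -!EFinM -EFinD.
by congr (_ <= _%:E)%E; ring.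
Qed.

(** The segment from [y] to [z] lies in the domain, so near [y] it cannot
    avoid all of the finitely many pieces. *)
Lemma active_direction_exists z : edom theta z ->
  exists i, active_direction i (z - y).
Proof.
move=> zdom; apply: contrapT => /forallNP nact.
have [[P Q] [/= P0 Qw] PQ] := filter_forall _
  (fun i => not_feasible_near (Omega_polyhedral i) (nact i)).
have [t [Pt [t0 t1]]] := filter_ex
  (filterI P0 (filterI (nbhs_right_gt 0) (nbhs_right_lt ltr01))).
have /PQ /= nO : (P `*` Q) (t, z - y) by split => //=; exact: nbhs_singleton.
have : edom theta (y + t *: (z - y)).
  apply: le_lt_trans (convex_ray zdom _) _; first by rewrite t0.
  exact: ltry.
by rewrite dom_theta => -[i _ /nO].
Qed.

(** Convexity makes the difference quotients along the segment from [y] to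
    [z] at most the total increment; their limit at [y] is the slope of the
    active piece. *)
Lemma active_growth z i : edom theta z -> active_direction i (z - y) ->
  fine (theta y) + dotv (u + slope_gap i) (z - y) <= fine (theta z).
Proof.
move=> zdom [Oy feas]; rewrite -lerBrDl -subr_ge0.
apply: (@affine_ge0_near0 _ (- (2^-1 * dotv ((z - y) *m A i) (z - y)))).
apply: filterS3 (nbhs_right_gt 0) (nbhs_right_lt ltr01) feas => t t0 t1 Oyt.
have := @convex_ray z t zdom; rewrite t0 => /(_ t1).
rewrite (piece_ray Oy Oyt) lee_fin lerD2l ler_pM2l// dotvDl; lra.
Qed.

(** Farkas' lemma bounds [v] by a multiple of the gap on each active cone,
    so a small multiple of [v] fits below all the gaps at once. *)
Lemma polar_multiplier v : polar_cone (critical_cone theta y u) v ->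
  exists2 t, 0 < t & subdifferential theta y (u + t *: v).
Proof.
move=> Kv.
have dominated i : \forall t \near (0 : R)^'+, forall w, active_direction i w ->
    t * dotv v w <= dotv (slope_gap i) w.
  have [Oy|nOy] := pselect (Omega i y); last by near=> t => w [].
  have [p [b [bO Ob]]] := polyhedral_feasible_cone (Omega_polyhedral i) Oy.
  have [w bw gap_le0|sigma sigma0 v_le] :=
      @farkas_multiplier _ _ _ b (slope_gap i) v.
    apply/Kv/critical_coneP.
    have act : active_direction i w by split => //; exact: Ob.
    by exists i => //; apply/eqP; rewrite eq_le gap_le0 slope_gap_ge0.
  (* The [+ 1] keeps the bound [t * sigma <= 1] meaningful for [sigma = 0]. *)
  have sigma1 : 0 < (sigma + 1)^-1 by rewrite invr_gt0 ltr_wpDl.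
  apply: filterS2 (nbhs_right_gt 0) (nbhs_right_le sigma1) => t t0 t_le w act.
  have gap0 := slope_gap_ge0 act.
  have [s' [s0 Os]] := filter_ex (filterI (nbhs_right_gt 0) act.2).
  apply: le_trans (_ : t * (sigma * dotv (slope_gap i) w) <= _).
    by rewrite ler_pM2l//; apply: v_le; exact: bO s0 Os.
  have t_sigma : t * (sigma + 1) <= 1 by rewrite -ler_pdivlMr ?div1r// ltr_wpDl.
  by rewrite mulrA ler_piMl//; lra.
have [t [t0 dom_t]] := filter_ex
  (filterI (nbhs_right_gt 0) (filter_forall _ dominated)).
exists t => //; split; first exact: sub_u.1.
move=> z; have [zdom|nzdom] := pselect (edom theta z); last first.
  by rewrite (theta_pinfty nzdom) leey.
have [i act] := active_direction_exists zdom.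
rewrite (thetaE_fine sub_u.1) (thetaE_fine zdom) -EFinD lee_fin.
apply: le_trans (active_growth zdom act).
by rewrite lerD2l 2!(dotvDl u) lerD2l dotvZl; exact: (dom_t i _ act).
Unshelve. all: by end_near. Qed.

(** Convexity of the set of subgradients at [y]: the subgradient inequality
    is affine in the multiplier. *)
Lemma subdifferential_segment t v r : 0 < t -> 0 <= r <= t ->
  subdifferential theta y (u + t *: v) -> subdifferential theta y (u + r *: v).
Proof.
move=> t0 /andP[r0 rt] sub_t; split; first exact: sub_u.1.
move=> z; have [zdom|nzdom] := pselect (edom theta z); last first.
  by rewrite (theta_pinfty nzdom) leey.
have := sub_t.2 z; have := sub_u.2 z.
rewrite (thetaE_fine sub_u.1) (thetaE_fine zdom) -!EFinD !lee_fin !dotvDl !dotvZl.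
set p := dotv u _; set q := dotv v _ => le0 let_.
have [q0|q0] := leP q 0.
  by apply: le_trans le0; rewrite lerD2l gerDl mulr_ge0_le0.
by apply: le_trans let_; rewrite !lerD2l ler_pM2r.
Qed.

Lemma multiplier_graphical_derivative t v : 0 < t ->
  subdifferential theta y (u + t *: v) ->
  graphical_derivative (subdifferential theta) y u 0 v.
Proof.
move=> t0 sub_t; exists (fun k => t * harmonic k), (fun=> (0, v)); split.
- by move=> k; rewrite mulr_gt0// /harmonic /= invr_gt0.
- rewrite -[X in _ --> X](mulr0 t).
  by apply: cvgM; [exact: cvg_cst|exact: cvg_harmonic].
- exact: cvg_cst.
- move=> k; rewrite /gph /= scaler0 addr0.
  apply: subdifferential_segment sub_t => //.
  rewrite mulr_ge0 ?(ltW t0) ?harmonic_ge0//= ger_pMr//.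
  by rewrite /harmonic /= invf_le1 ?ler1n.
Qed.

(** The subgradient inequality at the moving base points is tested at
    [y + (r * t k) *: w]: steps proportional to [t k] are the scale at which the
    second order terms of both sides are comparable. *)
Lemma graphical_derivative_polar v :
  graphical_derivative (subdifferential theta) y u 0 v ->
  polar_cone (critical_cone theta y u) v.
Proof.
move=> [t [wv [t0 tcvg wvcvg sub_k]]] w /critical_coneP [i [Oy feas] gap0].
have wcvg : (wv k).1 @[k --> \oo] --> (0 : 'rV[R]_m).
  exact: (cvg_comp _ _ wvcvg (@cvg_fst _ _ (nbhs (0 : 'rV[R]_m)) (nbhs v) _)).
have vcvg : (wv k).2 @[k --> \oo] --> v.
  exact: (cvg_comp _ _ wvcvg (@cvg_snd _ _ (nbhs (0 : 'rV[R]_m)) (nbhs v) _)).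
pose q := dotv (w *m A i) w.
(* It suffices that [dotv v w <= r * q / 2] for all small [r > 0]. *)
rewrite -oppr_ge0; apply: (@affine_ge0_near0 _ (2^-1 * q)).
apply: filterS (nbhs_right_gt 0) => r r0.
suff : r * dotv v w <= r ^+ 2 / 2 * q.
  by move=> le; rewrite -(pmulr_rge0 _ r0); lra.
have lhs_cvg : r * dotv (wv k).2 w - dotv (wv k).2 (wv k).1 @[k --> \oo] -->
    r * dotv v w - dotv v 0.
  apply: cvgB; first (apply: cvgM; first exact: cvg_cst).
    by apply: cvg_dotv => //; exact: cvg_cst.
  exact: cvg_dotv.
rewrite (dotvC v 0) dotv0l subr0 in lhs_cvg.
apply: (ler_cvg_to lhs_cvg (cvg_cst _)).
have rt_cvg : r * t k @[k --> \oo] --> (0 : R)^'+.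
  have rt0 : r * t k @[k --> \oo] --> (0 : R).
    rewrite -[X in _ --> X](mulr0 r).
    by apply: cvgM => //; exact: cvg_cst.
  move=> P [e e0 eP]; change (\forall k \near \oo, P (r * t k)).
  near=> k; apply: eP; last exact: mulr_gt0.
  by near: k; apply: rt0; exact: nbhsx_ballx.
have feas_k : \forall k \near \oo, Omega i (y + (r * t k) *: w).
  exact: rt_cvg _ feas.
apply: filterS feas_k => k /= Ok.
have [/= yk_dom /(_ (y + (r * t k) *: w))] := sub_k k.
have := subgradient_ray (t k) (wv k).1 sub_u.
rewrite (piece_ray Oy Ok) gap0 (thetaE_fine yk_dom) -EFinD !lee_fin.
rewrite opprD addrACA subrr add0r !dotvE -/q => le_u le_k.
(* The first order terms cancel, and what is left is of order [t k ^+ 2]. *)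
have tk2 : 0 < t k ^+ 2 by rewrite exprn_gt0.
rewrite -(ler_pM2l tk2); lra.
Unshelve. all: by end_near. Qed.

Lemma graphical_derivative0_eq :
  graphical_derivative (subdifferential theta) y u 0 =
  polar_cone (critical_cone theta y u).
Proof.
apply/seteqP; split=> v; first exact: graphical_derivative_polar.
by move=> /polar_multiplier[t t0]; exact: multiplier_graphical_derivative.
Qed.

End PiecewiseQuadratic.

(** * Uniqueness of multipliers *)

Lemma adjoint_derivativeDZ (R : realType) (n m : nat) (f : 'rV[R]_n -> 'rV[R]_m)
    x (u v : 'rV[R]_m) t :
  adjoint_derivative f x (u + t *: v) =
  adjoint_derivative f x u + t *: adjoint_derivative f x v.
Proof. by rewrite /adjoint_derivative mulmxDl scalemxAl. Qed.

Theorem theorem8p1 (R : realType) (n m : nat)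
    (phi0 : 'rV[R]_n -> R^o) (f : 'rV[R]_n -> 'rV[R]_m)
    (theta : 'rV[R]_m -> \bar R)
    (xbar : 'rV[R]_n) (lambdabar : 'rV[R]_m)
    (phi0_diff : twice_differentiable_scalar phi0 xbar)
    (f_diff : twice_differentiable f xbar)
    (theta_proper : never_ninfty theta)
    (theta_convex : convex_efun theta)
    (theta_plq : piecewise_linear_quadratic theta)
    (fxbar_dom : edom theta (f xbar))
    (kkt_bar : kkt phi0 f theta xbar lambdabar) :
  let vbar := - gradient phi0 xbar in
  let D0 := graphical_derivative (subdifferential theta) (f xbar) lambdabar 0 in
  D0 = polar_cone (critical_cone theta (f xbar) lambdabar) /\
  (multipliers f theta xbar vbar = [set lambdabar] <->
   D0 `&` [set u | adjoint_derivative f xbar u = 0] = [set 0]).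
Proof.
case: theta_plq => [p [ Omega [A [a [alpha [poly_pieces A_sym domE pieceE]]]]]].
have quadE i z : Omega i z ->
    theta z = (quadratic (A i) (a i) (alpha i) z)%:E by exact: pieceE.
case: kkt_bar => [stationary sub_bar] vbar D0.
have D0E : D0 = polar_cone (critical_cone theta (f xbar) lambdabar).
  exact: (graphical_derivative0_eq theta_proper theta_convex poly_pieces A_sym
    domE quadE sub_bar).
have adj_bar : adjoint_derivative f xbar lambdabar = vbar.
  by apply/eqP; rewrite -subr_eq0 opprK addrC stationary.
split=> //; rewrite D0E; split=> [single|qualification].
  apply/seteqP; split=> [v [/= Kv adj_v]|_ -> /=]; last first.
    split; last by rewrite /adjoint_derivative mul0mx.
    by move=> w _; rewrite dotv0l.
  have [t t0 sub_t] := polar_multiplier theta_proper theta_convex poly_pieces A_sym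
    domE quadE sub_bar Kv.
  have : multipliers f theta xbar vbar (lambdabar + t *: v).
    by split=> //; rewrite adjoint_derivativeDZ adj_bar adj_v scaler0 addr0.
  rewrite single /= => /eqP; rewrite addrC -subr_eq0 addrK scaler_eq0 gt_eqF//.
  by move=> /eqP.
apply/seteqP; split=> [lam [adj_lam sub_lam]|_ ->] //.
have : [set 0] (lam - lambdabar).
  rewrite -qualification; split.
    exact: (multiplier_polar theta_proper sub_bar sub_lam).
  by rewrite /= -scaleN1r adjoint_derivativeDZ adj_lam adj_bar scaleN1r subrr.
by move=> /eqP; rewrite subr_eq0 => /eqP.
Qed.
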